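(* Consider a stable ($\rho:=\frac{\alpha ES}{c}<1$) non-preemptive work-conserving $GI/GI/c$ discrete-time queueing system with $c$ parallel identical servers, in which a customer that finds idle servers picks one of them at random. Let $U=\sum_{i=1}^cU_i$ be the sum of the servers' long-run busy fractions (assumed to exist). Then for coherent systems $$U=\alpha\, ES.$$
   Context: Time is discrete, $\tau=0,1,2,\dots$. Customer $n$ arrives at the integer $A_n$ with integer service requirement $S_n\ge1$; $A_n\le A_{n+1}$, $A_n\to\infty$ (batches allowed); in $GI/GI/c$ the inter-arrival times are i.i.d., the service times are i.i.d., and the two sequences are independent; all statements hold almost surely. Let $A(\tau)=\max\{n:A_n\le\tau\}$, $\alpha=\lim_{\tau\to\infty}A(\tau)/\tau$ and $ES=\lim_{n\to\infty}n^{-1}\sum_{k=1}^nS_k$ (assumed to exist, finite). $D_n$ is the actual departure time of customer $n$ and $W_n=D_n-A_n$. Near each integer $\tau$ there are instants $\tau^{--}<\tau^-<\tau<\tau^+$ infinitesimally close to $\tau$ (formally $\tau-2\varepsilon,\ \tau-\varepsilon,\ \tau,\ \tau+\varepsilon$ with a fixed $0<\varepsilon<1/8$). A scheduling rule replaces $A_k,D_k$ by scheduled instants $A'_k,D'_k$ located as follows. EAS: $A'_k\in(A_k,A_k^+)$, $D'_k\in(D_k^-,D_k)$. LAS-IA: $A'_k\in(A_k^-,A_k)$, $D'_k\in(D_k-1,(D_k-1)^+)$. LAS-DA: $A'_k\in(A_k^-,A_k)$, $D'_k\in(D_k,D_k^+)$. LA-AF: $A'_k\in(A_k^{--},A_k^-)$,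 $D'_k\in(D_k^-,D_k)$. LA-DF: $A'_k\in(A_k^-,A_k)$, $D'_k\in(D_k^{--},D_k^-)$. The observation epoch $u(\tau)$ is one of: random observer, $u(\tau)=\tau$; outside observer, $u(\tau)=\tau-0.5$; or the potential pre-arrival, post-arrival, pre-departure, post-departure epochs, which are respectively $\tau,\tau^+,\tau^-,\tau$ for EAS; $\tau^-,\tau,\tau,\tau^+$ for LAS-IA and LAS-DA; $\tau^{--},\tau^-,\tau^-,\tau$ for LA-AF; $\tau^-,\tau,\tau^{--},\tau^-$ for LA-DF. The system is coherent if $\sum_{\tau\ge0}\mathbf 1\{A'_k<u(\tau)\le D'_k\}=W_k$ for all $k$. Non-preemptive and work conserving: a customer finding an idle server starts service at once ($A''_k=A'_k$, $D_k=A_k+S_k$); a customer who waits starts when the departure of some customer $j$ frees its server ($A''_k=D'_j$, $D_k=D_j+S_k$). Here $A''_k$ is the start of service. For $i=1,\dots,c$ let $B_i(\tau)=1$ if the $i$-th server is busy at the $\tau$-th observation epoch, i.e. some customer $k$ served by server $i$ has $A''_k<u(\tau)\le D'_k$, and $B_i(\tau)=0$ otherwise; let $Y_i(B,\tau)=\sum_{u=1}^\tau\mathbf 1\{B_i(u)=1\}$ and $U_i=\lim_{\tau\to\infty}Y_i(B,\tau)/\tau$. *)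

(* Defs.v *)
From HB Require Import structures.
From mathcomp Require Import all_boot all_order all_algebra.
From mathcomp Require Import all_classical all_reals all_analysis.

Set Implicit Arguments.
Unset Strict Implicit.
Unset Printing Implicit Defensive.
Import Order.TTheory GRing.Theory Num.Theory.
Import numFieldNormedType.Exports.
Local Open Scope classical_set_scope.
Local Open Scope ring_scope.

Inductive scheduling_rule := EAS | LAS_IA | LAS_DA | LA_AF | LA_DF.

Inductive observer :=
  RandomObserver | OutsideObserver
| PreArrival | PostArrival | PreDeparture | PostDeparture.

(* One realization of a queue with c servers.  Sequences are indexed from 0:
   index k stands for customer number k + 1. *)
Record sample_path (R : realType) (c : nat) := SamplePath {
  arr : nat -> nat;       (* A_k *)
  req : nat -> nat;       (* S_k *)
  dep : nat -> nat;       (* D_k *)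
  server : nat -> 'I_c;   (* the server that serves customer k *)
  sarr : nat -> R;        (* A'_k *)
  sdep : nat -> R;        (* D'_k *)
  start : nat -> R        (* A''_k *)
}.

Section Schedule.
Variables (R : realType) (eps : R).

Definition mminus (x : R) : R := x - eps *+ 2.
Definition minus (x : R) : R := x - eps.
Definition plus (x : R) : R := x + eps.

Definition arrival_window (r : scheduling_rule) (a : nat) : set R :=
  let x : R := a%:R in
  match r with
  | EAS => `]x, plus x[
  | LAS_IA | LAS_DA | LA_DF => `]minus x, x[
  | LA_AF => `]mminus x, minus x[
  end.

Definition departure_window (r : scheduling_rule) (b : nat) : set R :=
  let x : R := b%:R in
  match r with
  | EAS | LA_AF => `]minus x, x[
  | LAS_IA => `](x - 1), plus (x - 1)[
  | LAS_DA => `]x, plus x[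
  | LA_DF => `]mminus x, minus x[
  end.

Definition epoch (r : scheduling_rule) (o : observer) (t : nat) : R :=
  let x : R := t%:R in
  match o with
  | RandomObserver => x
  | OutsideObserver => x - 2^-1
  | PreArrival =>
      match r with
      | EAS => x
      | LAS_IA | LAS_DA | LA_DF => minus x
      | LA_AF => mminus x
      end
  | PostArrival =>
      match r with
      | EAS => plus x
      | LAS_IA | LAS_DA | LA_DF => x
      | LA_AF => minus x
      end
  | PreDeparture =>
      match r with
      | EAS | LA_AF => minus x
      | LAS_IA | LAS_DA => x
      | LA_DF => mminus x
      end
  | PostDeparture =>
      match r with
      | EAS | LA_AF => x
      | LAS_IA | LAS_DA => plus x
      | LA_DF => minus x
      end
  end.

End Schedule.

Section Paths.
Variables (R : realType) (c : nat).
Implicit Types (q : sample_path R c) (i : 'I_c) (j k : nat) (x : R).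

Definition valid_input q : Prop :=
  [/\ forall n, (arr q n <= arr q n.+1)%N,
      arr q n @[n --> \oo] --> \oo
    & forall n, (1 <= req q n)%N].

Definition scheduled (eps : R) (r : scheduling_rule) q : Prop :=
  forall k, arrival_window eps r (arr q k) (sarr q k) /\
            departure_window eps r (dep q k) (sdep q k).

Definition coherent (eps : R) (r : scheduling_rule) (o : observer) q : Prop :=
  forall k,
    (\sum_(0 <= t <oo)
        ((sarr q k < epoch eps r o t <= sdep q k)%R : nat)%:R%:E
     = ((dep q k)%:R - (arr q k)%:R)%R%:E :> \bar R)%E.

Definition in_service q k x : Prop := start q k < x <= sdep q k.

Definition busy q i x : Prop := exists2 k, server q k = i & in_service q k x.

(* Members of a batch may share the same scheduled arrival instant; they are
   then admitted one after the other, in the order of their numbers. *)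
Definition arrives_before q j k : Prop :=
  sarr q j < sarr q k \/ (sarr q j = sarr q k /\ (j < k)%N).

Definition occupied_on_arrival q i k : Prop :=
  exists2 j, server q j = i &
    in_service q j (sarr q k) \/ (start q j = sarr q k /\ (j < k)%N).

Definition found_idle q k : {set 'I_c} :=
  [set i | `[< ~ occupied_on_arrival q i k >] ]%SET.

Record nonpreemptive_work_conserving q : Prop := {
  one_customer_at_a_time : forall j k, j <> k -> server q j = server q k ->
    sdep q j <= start q k \/ sdep q k <= start q j;
  start_at_once : forall k, found_idle q k != finset.set0 ->
    [/\ server q k \in found_idle q k,
        start q k = sarr q k
      & dep q k = (arr q k + req q k)%N];
  start_after_wait : forall k, found_idle q k = finset.set0 ->
    exists j, [/\ server q j = server q k,
                  sarr q k < sdep q j,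
                  start q k = sdep q j
                & dep q k = (dep q j + req q k)%N];
  no_idling : forall k x i, sarr q k < x <= start q k -> busy q i x
}.

(* A(t) = max {n : A_n <= t} with customers numbered from 1, and 0 if nobody
   has arrived by time t. *)
Definition arrivals q (t : nat) : nat :=
  xget 0%N [set n | [/\ (0 < n)%N, (arr q n.-1 <= t)%N &
                     forall m, (0 < m)%N -> (arr q m.-1 <= t)%N -> (m <= n)%N]].

Definition arrival_rate q (alpha : R) : Prop :=
  ((arrivals q t)%:R / t%:R : R) @[t --> \oo] --> alpha.

Definition mean_requirement q (ES : R) : Prop :=
  (n%:R^-1 * \sum_(k < n) (req q k)%:R : R) @[n --> \oo] --> ES.

Definition busy_slots (eps : R) (r : scheduling_rule) (o : observer) q i
    (t : nat) : nat :=
  (\sum_(1 <= v < t.+1) `[< busy q i (epoch eps r o v) >])%N.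

Definition busy_fraction (eps : R) (r : scheduling_rule) (o : observer) q i
    (Ui : R) : Prop :=
  ((busy_slots eps r o q i t)%:R / t%:R : R) @[t --> \oo] --> Ui.

End Paths.

Section Probability.
Context (d : measure_display) (T : measurableType d) (R : realType).
Variable P : probability T R.
Implicit Types X Y : nat -> T -> nat.

Definition mutually_independent X : Prop :=
  forall (J : seq nat) (B : nat -> set nat), uniq J ->
    P (\bigcap_(j in [set` J]) X j @^-1` B j)
    = (\prod_(j <- J) P (X j @^-1` B j))%E.

Definition identically_distributed X : Prop :=
  forall n (B : set nat), P (X n @^-1` B) = P (X 0%N @^-1` B).

Definition iid X : Prop := mutually_independent X /\ identically_distributed X.

Definition sigma_of X : set (set T) :=
  <<s [set E | exists n (B : set nat), E = X n @^-1` B] >>.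

Definition independent_sequences X Y : Prop :=
  forall E F, sigma_of X E -> sigma_of Y F -> P (E `&` F) = (P E * P F)%E.

Variable c : nat.
Implicit Type Q : T -> sample_path R c.

Record measurable_system Q : Prop := {
  measurable_arr : forall n, measurable_fun setT (fun w => arr (Q w) n);
  measurable_req : forall n, measurable_fun setT (fun w => req (Q w) n);
  measurable_dep : forall n, measurable_fun setT (fun w => dep (Q w) n);
  measurable_server : forall n i, measurable [set w | server (Q w) n = i];
  measurable_sarr : forall n, measurable_fun setT (fun w => sarr (Q w) n);
  measurable_sdep : forall n, measurable_fun setT (fun w => sdep (Q w) n);
  measurable_start : forall n, measurable_fun setT (fun w => start (Q w) n)
}.

Definition interarrival Q (n : nat) (w : T) : nat :=
  (arr (Q w) n.+1 - arr (Q w) n)%N.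

Definition requirement Q (n : nat) (w : T) : nat := req (Q w) n.

(* The law of the first arrival instant is left free. *)
Definition GI_GI_input Q : Prop :=
  [/\ iid (interarrival Q), iid (requirement Q)
    & independent_sequences (interarrival Q) (requirement Q)].

Definition choice_history Q (k : nat) : set (set T) :=
  <<s [set E | [\/ exists n m, E = [set w | arr (Q w) n = m],
                   exists n m, E = [set w | req (Q w) n = m]
                 | exists j i, E = [set w | arrives_before (Q w) j k /\
                                            server (Q w) j = i]]] >>.

(* Given the set I of idle servers that customer k finds, the arrival and
   service sequences, and the servers of the customers that came before k, the
   server of customer k is uniformly distributed on I. *)
Definition random_choice Q : Prop :=
  forall k (E : set T) (I : {set 'I_c}) (i : 'I_c),
    choice_history Q k E -> i \in I ->
    P (E `&` [set w | found_idle (Q w) k = I] `&` [set w | server (Q w) k = i])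
    = ((#|I|%:R^-1)%:E * P (E `&` [set w | found_idle (Q w) k = I]))%E.

End Probability.

(* Main.v *)
Require Import Defs.
From HB Require Import structures.
From mathcomp Require Import all_boot all_order all_algebra.
From mathcomp Require Import all_classical all_reals all_analysis.
From mathcomp Require Import ring lra zify.
Set Implicit Arguments.
Unset Strict Implicit.
Unset Printing Implicit Defensive.
Import Order.TTheory GRing.Theory Num.Theory.
Import numFieldNormedType.Exports.
Local Open Scope classical_set_scope.
Local Open Scope ring_scope.

(** The identity holds on every single sample path that satisfies the
    almost sure hypotheses: it is conservation of work, whatever the order in
    which waiting customers are served.

    Each customer occupies a server at exactly [req q k] epochs
    ([full_service]).  For a customer who starts on arrival this is coherence.
    For one who waits, the service runs from one scheduled departure to another,
    and departure instants all sit in the same phase relative to the grid of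
    epochs ([departure_phase]), so that the number of epochs in between is the
    difference of the two departure slots.

    Let [V t] be the number of pairs of a server and an epoch among 1, .., t at
    which it is busy, and let [W t] be the total requirement of the customers
    who arrived by time [t].  The limits that define [alpha] and [ES], the
    second one composed with the counting process of the arrivals ([cvg_change_of_clock]), give
    [W t / t --> alpha * ES], while [V t / t] tends to the sum of the busy
    fractions.  As no customer receives more than the requirement,
    [V t <= W t] ([busy_slots_le_work]), whence one inequality.

    For the other one, suppose that the sum is less than [alpha * ES].  Then
    [W t - V t] grows linearly.  If nobody is waiting at epoch [t.+1], all
    of this unfinished work belongs to the at most [c] customers in service
    ([work_le_busy_slots]), so it is at most [c] times the largest requirement
    seen so far up to a constant, and that is o(t) because the requirements have
    a Cesaro limit ([cvg_mean_max]).  Hence from some time on somebody is always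
    waiting, so by work conservation every server is always busy, all busy
    fractions are at least 1, and their sum is at least [c > alpha * ES]. *)

(** * Position of the scheduled instants relative to the epochs *)

Section Epochs.
Variables (R : realType) (eps : R) (r : scheduling_rule) (o : observer).
Hypothesis eps_bounds : 0 < eps < 8^-1.

Lemma epoch_shift t : epoch eps r o t = epoch eps r o 0 + t%:R.
Proof.
by case: o; case: r; rewrite /epoch /minus /mminus /plus; ring.
Qed.

Lemma epoch_homo : {mono epoch eps r o : s t / (s <= t)%N >-> s <= t}.
Proof.
by move=> s t; rewrite (epoch_shift s) (epoch_shift t) lerD2l ler_nat.
Qed.

Lemma epoch_bounds t : t%:R - 2^-1 <= epoch eps r o t <= t%:R + eps.
Proof.
have [e0 e8] := andP eps_bounds.
by case: o; case: r; rewrite /epoch /minus /mminus /plus;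
  apply/andP; split; lra.
Qed.

Lemma arrival_window_bounds a x : arrival_window eps r a x ->
  a%:R - eps *+ 2 < x < a%:R + eps.
Proof.
have [e0 e8] := andP eps_bounds.
case: r; rewrite /= in_itv /= /minus /mminus /plus => /andP[? ?].
all: by apply/andP; split; lra.
Qed.

Lemma epoch_after_arrival a x t : arrival_window eps r a x ->
  (a < t)%N -> x < epoch eps r o t.
Proof.
move=> /arrival_window_bounds /andP[_ xa]; rewrite -(ler_nat R) -natr1 => a1t.
by have /andP[ut _] := epoch_bounds t; have [e0 e8] := andP eps_bounds; lra.
Qed.

Lemma arrival_before_epoch a x t : arrival_window eps r a x ->
  x < epoch eps r o t -> (a <= t)%N.
Proof.
move=> /arrival_window_bounds/andP[+ _] xt; rewrite -ltnS -(ltr_nat R) -natr1.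
have /andP[_ ut] := epoch_bounds t; have [e0 e8] := andP eps_bounds.
lra.
Qed.

(** Epochs advance by 1 and so do the departure windows, and no epoch falls
    strictly inside a window.  Hence the last epoch not later than a departure
    is the departure slot minus an offset [s] that depends only on the rule and
    the observer: it is 2 for post-departure epochs of LAS-IA, for instance. *)
Lemma departure_phase : exists2 s, (s <= 2)%N &
  forall b x t, departure_window eps r b x ->
    (epoch eps r o t <= x) = (t + s <= b)%N.
Proof.
have [s s2 sP] : exists2 s, (s <= 2)%N & forall b x,
    departure_window eps r b x ->
    b%:R <= x + s%:R - epoch eps r o 0 < b%:R + 1.
  have [e0 e8] := andP eps_bounds.
  by case: o; case: r; rewrite /= /minus /mminus /plus;
    first [ exists 0%N => // b x; rewrite /= in_itv /= => /andP[? ?];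
            apply/andP; split; lra
          | exists 1%N => // b x; rewrite /= in_itv /= => /andP[? ?];
            apply/andP; split; lra
          | exists 2 => // b x; rewrite /= in_itv /= => /andP[? ?];
            apply/andP; split; lra ].
exists s => // b x t /sP bx; rewrite epoch_shift.
apply/idP/idP => [ux|].
  rewrite -ltnS -(ltr_nat R) natrD -natr1; lra.
by rewrite -(ler_nat R) natrD; lra.
Qed.
End Epochs.

Lemma count_shift_le s b n : (b < n + s)%N ->
  (\sum_(0 <= v < n) (v + s <= b)%N)%N = (b.+1 - s)%N.
Proof.
move=> bn.
rewrite (@big_cat_nat _ _ _ (b.+1 - s)%N)//=; last by lia.
rewrite (eq_big_nat _ _ (F2 := fun=> 1%N)); last first.
  by move=> v vb; have -> : (v + s <= b)%N by lia.
rewrite sum_nat_const_nat muln1 subn0 big_nat_cond big1 ?addn0// => v.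
by rewrite andbT => vb; apply/eqP; rewrite eqb0; lia.
Qed.

(** * Service received on one sample path *)

Definition work (R : realType) (c : nat) (q : sample_path R c) (n : nat) : nat :=
  (\sum_(k < n) req q k)%N.

(** Epoch 0 is left out, to match [busy_slots]. *)
Definition service_slots (R : realType) (c : nat) (q : sample_path R c)
    (eps : R) (r : scheduling_rule) (o : observer) (k t : nat) : nat :=
  (\sum_(1 <= v < t.+1) (start q k < epoch eps r o v <= sdep q k)%R)%N.

Section Queue.
Variables (R : realType) (c : nat) (q : sample_path R c).
Variables (eps : R) (r : scheduling_rule) (o : observer).
Hypothesis eps_bounds : 0 < eps < 8^-1.
Hypothesis input : valid_input q.
Hypothesis sched : scheduled eps r q.
Hypothesis serve : nonpreemptive_work_conserving q.
Hypothesis coh : coherent eps r o q.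

Local Notation u := (epoch eps r o).
Local Notation serving k x := (start q k < x <= sdep q k).
Local Notation slots := (service_slots q eps r o).

(** The characterization also covers the times at which nobody has arrived:
    the set that defines [arrivals] is then empty, and the default is 0. *)
Lemma lt_arrivals k t : (k < arrivals q t)%N = (arr q k <= t)%N.
Proof.
have [arrS /cvgnyPgt arroo _] := input.
have arr_homo : {homo arr q : i j / (i <= j)%N}.
  by apply: homo_leq arrS => // ? ? ?; apply: leq_trans.
have [M _ late] := arroo t.
rewrite /arrivals; case: xgetP => [n nE [n_gt0 nt nmax]|none].
  apply/idP/idP => [kn|kt]; last exact: (nmax k.+1).
  by apply: leq_trans nt; apply: arr_homo; rewrite -ltnS prednK.
rewrite ltn0; apply/esym/negbTE/negP => kt.
have present_le m : (0 < m)%N && (arr q m.-1 <= t)%N -> (m <= M)%N.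
  case: m => //= m mt; rewrite ltnNge; apply/negP => Mm.
  by have := late m Mm; rewrite /= ltnNge mt.
have ex_present : exists m, (0 < m)%N && (arr q m.-1 <= t)%N by exists k.+1.
case: (ex_maxnP ex_present present_le) => m /andP[m_gt0 mt] m_max.
by apply: (none m); split=> // n n_gt0 nt; apply: m_max; rewrite n_gt0.
Qed.

Lemma arrivals_cvg : arrivals q t @[t --> \oo] --> \oo.
Proof.
apply/cvgnyPgt => n; exists (arr q n) => // t /= nt.
by rewrite lt_arrivals.
Qed.

Lemma sarr_le_start k : sarr q k <= start q k.
Proof.
have [idle0|/(start_at_once serve)[_ -> _]//] :=
  eqVneq (found_idle q k) finset.set0.
by have [j [_ /ltW kj -> _]] := start_after_wait serve idle0.
Qed.

Lemma dep_gt0 k : (0 < dep q k)%N.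
Proof.
have [_ _ /(_ k) req1] := input.
have [idle0|/(start_at_once serve)[_ _ ->]] :=
  eqVneq (found_idle q k) finset.set0.
  by have [j [_ _ _ ->]] := start_after_wait serve idle0;
    rewrite addn_gt0 req1 orbT.
by rewrite addn_gt0 req1 orbT.
Qed.

(** Past the departure the terms of the coherence series vanish, so the series
    is a finite sum. *)
Lemma sum_coherent k n : sdep q k < u n ->
  (\sum_(0 <= v < n) (sarr q k < u v <= sdep q k)%R)%N%:R
    = (dep q k)%:R - (arr q k)%:R :> R.
Proof.
move=> gone; apply: EFin_inj; rewrite -(coh k).
rewrite (nneseries_split 0 n); last by move=> ? _; rewrite lee_fin.
rewrite add0n (@eseries0 _ _ n) ?adde0 ?natr_sum ?sumEFin// => v nv _.
rewrite [X in (_ && X)]leNgt (lt_le_trans gone) ?andbF//.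
by rewrite epoch_homo.
Qed.

(** This is where coherence is used, for a customer who starts on arrival.  A
    customer who waits is served from one departure to another, which is counted
    by [departure_phase]. *)
Lemma full_service k n : sdep q k < u n ->
  (\sum_(0 <= v < n) (serving k (u v))%R)%N = req q k.
Proof.
move=> gone.
have [idle0|/(start_at_once serve)[_ st dp]] :=
  eqVneq (found_idle q k) finset.set0; last first.
  apply/eqP; rewrite -(eqr_nat R); move/eqP: (sum_coherent gone).
  by rewrite dp natrD addrAC subrr add0r st.
have [j [jk _ st dp]] := start_after_wait serve idle0.
have [s s2 sP] := departure_phase r o eps_bounds.
have phase i v : (u v <= sdep q i) = (v + s <= dep q i)%N.
  by apply: sP; case: (sched i).
have [_ _ /(_ k) req1] := input; have dep1 := dep_gt0 j.
(* The epochs up to D'_k split into those up to D'_j and those of service. *)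
have jk_dep : (\sum_(0 <= v < n) (serving k (u v))%R
    + \sum_(0 <= v < n) (u v <= sdep q j)%R
    = \sum_(0 <= v < n) (u v <= sdep q k)%R)%N.
  rewrite -big_split; apply: eq_bigr => v _ /=.
  rewrite st ltNge !phase; lia.
have kn : (dep q k < n + s)%N by rewrite ltnNge -phase -ltNge.
move: jk_dep; under [X in (_ + X)%N]eq_bigr do rewrite phase.
under [X in _ = X]eq_bigr do rewrite phase.
by rewrite !count_shift_le//; lia.
Qed.

Lemma partial_service k n : (\sum_(0 <= v < n) (serving k (u v))%R <= req q k)%N.
Proof.
have [s s2 sP] := departure_phase r o eps_bounds.
set m := (dep q k).+1; have gone : sdep q k < u (n + m)%N.
  by rewrite ltNge (sP _ _ _ (sched k).2) /m; lia.
by rewrite -(full_service gone) [leqRHS](@big_cat_nat _ _ _ n) ?leq_addr//=.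
Qed.

Lemma serving_le1 i x n : (\sum_(k < n | server q k == i) (serving k x)%R <= 1)%N.
Proof.
have [/existsP[k /andP[ki kx]]|] :=
  boolP [exists k : 'I_n, (server q k == i) && serving k x].
  rewrite (bigD1 k)//= kx big1 ?addn0// => j /andP[ji jk].
  apply/eqP; rewrite eqb0; apply/negP => /andP[xj jx].
  move: kx => /andP[xk kx].
  have /(one_customer_at_a_time serve) : (j : nat) <> k.
    by move=> /val_inj jkE; rewrite jkE eqxx in jk.
  rewrite (eqP ji) (eqP ki) => /(_ erefl)[] le.
    by have := lt_le_trans xk (le_trans jx le); rewrite ltxx.
  by have := lt_le_trans xj (le_trans kx le); rewrite ltxx.
rewrite negb_exists => /forallP nobody; rewrite big1// => k ki.
by have := nobody k; rewrite ki /= => /negbTE ->.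
Qed.

Lemma sum_by_server n x :
  (\sum_(k < n) (serving k x)%R
    = \sum_(i < c) \sum_(k < n | server q k == i) (serving k x)%R)%N.
Proof. exact: (partition_big (fun k : 'I_n => server q k) xpredT). Qed.

Lemma serving_le_servers n x : (\sum_(k < n) (serving k x)%R <= c)%N.
Proof.
rewrite sum_by_server -[leqRHS]card_ord -sum1_card; apply: leq_sum => i _.
exact: serving_le1.
Qed.

(** The intervals of service at one server are disjoint, so a busy server
    contributes exactly one customer. *)
Lemma sum_busy n x : (forall k, serving k x -> (k < n)%N) ->
  (\sum_(i < c) `[< busy q i x >] = \sum_(k < n) (serving k x)%R)%N.
Proof.
move=> all_lt; rewrite sum_by_server; apply: eq_bigr => i _.
have := serving_le1 i x n; case: asboolP => [[k ki kx]|idle].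
  by rewrite (bigD1 (Ordinal (all_lt k kx))) ?ki//= kx; lia.
move=> _; rewrite big1// => k /eqP ki; apply/eqP; rewrite eqb0.
by apply/negP => kx; apply: idle; exists k.
Qed.

Lemma serving_arrived k t : serving k (u t) -> (arr q k <= t)%N.
Proof.
move=> /andP[kt _]; apply: (arrival_before_epoch eps_bounds (sched k).1).
exact: le_lt_trans (sarr_le_start k) kt.
Qed.

Lemma sum_busy_slots t :
  (\sum_(i < c) busy_slots eps r o q i t = \sum_(k < arrivals q t) slots k t)%N.
Proof.
rewrite /service_slots /busy_slots exchange_big [RHS]exchange_big.
apply: eq_big_nat => v /andP[_ vt].
apply: sum_busy => k /serving_arrived kv.
by rewrite lt_arrivals (leq_trans kv).
Qed.

Lemma sum_serving k t :
  (\sum_(0 <= v < t.+1) (serving k (u v))%R = (serving k (u 0))%R + slots k t)%N.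
Proof. by rewrite big_ltn. Qed.

Lemma busy_slots_le_work t :
  (\sum_(i < c) busy_slots eps r o q i t <= work q (arrivals q t))%N.
Proof.
rewrite sum_busy_slots; apply: leq_sum => k _.
by apply: leq_trans (partial_service k t.+1); rewrite sum_serving leq_addl.
Qed.

(** If nobody waits at epoch [t.+1], the customers who arrived by time [t]
    have left, with their requirement met, or are among the at most [c] in
    service.  The constant [c] pays for epoch 0, which [busy_slots] does not
    count. *)
Lemma work_le_busy_slots t :
    (forall k, ~ (sarr q k < u t.+1 <= start q k)) ->
  (work q (arrivals q t) <= \sum_(i < c) busy_slots eps r o q i t + c
                          + c * \max_(k < arrivals q t) req q k)%N.
Proof.
move=> none_waits; set M := (\max_(k < _) _)%N.
have split_work (k : 'I_(arrivals q t)) :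
    (req q k <= slots k t + (serving k (u 0))%R
                + (serving k (u t.+1))%R * M)%N.
  have reqM : (req q k <= M)%N by rewrite /M (leq_bigmax k).
  have started : start q k < u t.+1.
    rewrite ltNge; apply/negP => wait; apply: (none_waits k); rewrite wait andbT.
    by apply: (epoch_after_arrival o eps_bounds (sched k).1);
      rewrite ltnS -lt_arrivals.
  have [kx|idle] := boolP (serving k (u t.+1)); first by rewrite mul1n; lia.
  have gone : sdep q k < u t.+1.
    by move: idle; rewrite started /= -ltNge.
  (* Epoch [t.+1] comes after the departure, so epochs 0, .., t cover it all. *)
  by rewrite -(full_service gone) sum_serving; lia.
apply: (leq_trans (leq_sum _ (fun k _ => split_work k))).
rewrite !big_split /= sum_busy_slots -big_distrl /=.
by rewrite !leq_add// ?leq_mul// serving_le_servers.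
Qed.

Lemma busy_slots_full t0 t i :
  (forall v, (t0 < v)%N -> busy q i (u v)) ->
  (t <= busy_slots eps r o q i t + t0)%N.
Proof.
move=> full; elim: t => // t IH; rewrite /busy_slots big_nat_recr//=
  -/(busy_slots eps r o q i t).
have [tt0|tt0] := leqP t0 t; last by lia.
by rewrite asboolT; [lia|exact: full].
Qed.
End Queue.

(** * Long-run averages *)

Section Averages.
Variable R : realType.
Implicit Types (g : nat -> R) (x N : nat -> nat).

Lemma cvg_div_n (a : R) : (a / t%:R : R) @[t --> \oo] --> (0 : R).
Proof.
rewrite -[X in _ --> X](mulr0 a); apply: cvgMl_tmp.
by rewrite -cvg_shiftS; exact: cvg_harmonic.
Qed.

Lemma cvg_change_of_clock g N (l a : R) :
    N t @[t --> \oo] --> \oo -> ((N t)%:R / t%:R : R) @[t --> \oo] --> a ->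
    (g n / n%:R) @[n --> \oo] --> l ->
  (g (N t) / t%:R) @[t --> \oo] --> a * l.
Proof.
move=> Noo Na gl.
apply: cvg_trans (cvgM Na (cvg_comp _ _ Noo gl)); apply: near_eq_cvg.
have /cvgnyPgt/(_ 0%N) := Noo; apply: filterS => t Nt0 /=.
have N0 : (N t)%:R != 0 :> R by rewrite pnatr_eq0 -lt0n.
by rewrite mulrC mulrA divfK.
Qed.

(** With s_n the mean of the first n terms, the last term divided by n + 1 is
    s_(n+1) - s_n + s_n / (n + 1). *)
Lemma cvg_mean_last x (l : R) :
    (n%:R^-1 * \sum_(k < n) (x k)%:R : R) @[n --> \oo] --> l ->
  ((x n)%:R / n.+1%:R : R) @[n --> \oo] --> (0 : R).
Proof.
move=> sl; have sl1 := sl; rewrite -cvg_shiftS /= in sl1.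
rewrite -[X in _ --> X](mulr0 l) -[X in _ --> X]add0r -[X in X + _](subrr l).
apply: cvg_trans (cvgD (cvgB sl1 sl) (cvgM sl cvg_harmonic)).
apply: near_eq_cvg; near=> n => /=.
have n0 : n%:R != 0 :> R by rewrite pnatr_eq0 -lt0n; near: n; exact: nbhs_infty_gt.
have n1 : 1 + n%:R != 0 :> R by rewrite addrC natr1 pnatr_eq0.
rewrite !fctE /= big_ord_recr /= -natr1 [n%:R + 1]addrC; field.
by rewrite n0 n1.
Unshelve. all: by end_near. Qed.

(** A term is at most e / 2 times its rank, except for finitely many terms,
    which are all bounded by the constant [C]. *)
Lemma cvg_mean_max x (l : R) :
    (n%:R^-1 * \sum_(k < n) (x k)%:R : R) @[n --> \oo] --> l ->
  ((\max_(k < n) x k)%:R / n%:R : R) @[n --> \oo] --> (0 : R).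
Proof.
move=> /cvg_mean_last/cvgr0Pnorm_le x_small; apply/cvgr0Pnorm_le => e e0.
have e20 : 0 < e / 2 by lra.
have [n0 _ n0P] := x_small _ e20.
set C : R := (\sum_(k < n0) x k)%:R.
near=> n.
have n_gt0 : 0 < n%:R :> R by rewrite ltr0n; near: n; exact: nbhs_infty_gt.
have Cn : C <= e / 2 * n%:R.
  rewrite -ler_pdivrMl//; near: n; exact: nbhs_infty_ger.
rewrite ger0_norm ?divr_ge0// ler_pdivrMr//.
have n_pos : (0 < #|'I_n|)%N by rewrite card_ord -(ltr0n R).
have [k ->] := bigop.eq_bigmax (fun k : 'I_n => x k) n_pos.
have en_ge0 : 0 <= e / 2 * n%:R by exact: mulr_ge0 (ltW _) (ltW _).
have [kn0|n0k] := ltnP k n0.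
  apply: (@le_trans _ _ C).
    by rewrite ler_nat (bigD1 (Ordinal kn0))//= leq_addr.
  by lra.
have := n0P _ n0k; rewrite /= ger0_norm ?divr_ge0// ler_pdivrMr//.
have : e / 2 * k.+1%:R <= e / 2 * n%:R by rewrite ler_pM2l// ler_nat.
lra.
Unshelve. all: by end_near. Qed.
End Averages.

(** * Conservation of work *)

(** The deterministic form of the result: the two inequalities for a single
    sample path. *)
Lemma sum_busy_fractions (R : realType) (c : nat) (q : sample_path R c)
    (eps : R) (r : scheduling_rule) (o : observer) (alpha ES : R)
    (U : 'I_c -> R) :
    (0 < c)%N -> 0 < eps < 8^-1 -> alpha * ES / c%:R < 1 ->
    valid_input q -> scheduled eps r q -> nonpreemptive_work_conserving q ->
    arrival_rate q alpha -> mean_requirement q ES -> coherent eps r o q ->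
    (forall i, busy_fraction eps r o q i (U i)) ->
  \sum_(i < c) U i = alpha * ES.
Proof.
move=> c_gt0 eps_bounds + input sched serve rate mean coh frac.
rewrite ltr_pdivrMr ?ltr0n// mul1r => stable.
pose V t := (\sum_(i < c) busy_slots eps r o q i t)%N.
have Noo := arrivals_cvg input.
have V_cvg : ((V t)%:R / t%:R : R) @[t --> \oo] --> \sum_(i < c) U i.
  rewrite (_ : (fun t => _) =
      fun t => \sum_(i < c) ((busy_slots eps r o q i t)%:R / t%:R : R)).
    by apply: cvg_big => [|i _]; [exact: add_continuous|exact: frac].
  by apply/funext => t; rewrite natr_sum mulr_suml.
have work_cvg :
    ((work q (arrivals q t))%:R / t%:R : R) @[t --> \oo] --> alpha * ES.
  apply: (cvg_change_of_clock (g := fun n => (work q n)%:R) Noo rate).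
  by move: mean; rewrite /mean_requirement; under eq_fun do rewrite mulrC -natr_sum.
have max_cvg :
    ((\max_(k < arrivals q t) req q k)%:R / t%:R : R) @[t --> \oo] --> alpha * 0.
  apply: (cvg_change_of_clock (g := fun n => (\max_(k < n) req q k)%:R) Noo rate).
  exact: cvg_mean_max mean.
have U_le : \sum_(i < c) U i <= alpha * ES.
  apply: (ler_cvg_to V_cvg work_cvg); apply: nearW => t.
  rewrite ler_wpM2r ?invr_ge0// ler_nat.
  exact: (busy_slots_le_work eps_bounds).
apply/eqP; rewrite eq_le U_le /= leNgt; apply/negP => U_lt.
(* By [work_le_busy_slots], somebody is waiting when [excess t > 0]. *)
pose excess t : R := (work q (arrivals q t))%:R / t%:R - (V t)%:R / t%:R
  - c%:R / t%:R - c%:R * ((\max_(k < arrivals q t) req q k)%:R / t%:R).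
have excess_cvg : excess t @[t --> \oo] --> alpha * ES - \sum_(i < c) U i.
  suff : excess t @[t --> \oo] -->
      alpha * ES - \sum_(i < c) U i - 0 - c%:R * (alpha * 0).
    by rewrite !mulr0 !subr0.
  apply: cvgB; last exact: cvgMl_tmp.
  by apply: cvgB; [exact: cvgB|exact: cvg_div_n].
have : \forall t \near \oo, exists k, sarr q k < epoch eps r o t.+1 <= start q k.
  have : 0 < alpha * ES - \sum_(i < c) U i by rewrite subr_gt0.
  move=> /(cvgr_gt _ excess_cvg); apply: filterS => t.
  rewrite /excess => t_excess.
  apply/not_existsP => none_waits.
  have := work_le_busy_slots eps_bounds input sched serve coh none_waits.
  rewrite -(ler_nat R) !natrD natrM -/(V t) leNgt => /negP; apply.
  have [t0|t_gt0] := posnP t; first by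
    move: t_excess; rewrite t0 invr0 !mulr0 !subr0 ltxx.
  have tR : 0 < t%:R :> R by rewrite ltr0n.
  move: t_excess; rewrite mulrA -!mulrBl pmulr_lgt0 ?invr_gt0//.
  by lra.
move=> [t0 _ waits].
have full i v : (t0 < v)%N -> busy q i (epoch eps r o v).
  by case: v => // v /waits[k kv]; exact: (no_idling serve) kv.
have U_ge1 i : 1 <= U i.
  have one_cvg : (1 - t0%:R / t%:R : R) @[t --> \oo] --> (1 : R).
    by rewrite -[X in _ --> X]subr0; apply: cvgB;
      [exact: cvg_cst|exact: cvg_div_n].
  apply: (ler_cvg_to one_cvg (frac i)).
  near=> t.
  have tR : 0 < t%:R :> R by rewrite ltr0n; near: t; exact: nbhs_infty_gt.
  rewrite ler_pdivlMr// mulrBl mul1r divfK ?gt_eqF// lerBlDr -natrD ler_nat.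
  exact: busy_slots_full (full i).
have : c%:R <= \sum_(i < c) U i.
  by rewrite -[c in c%:R]card_ord -sum1_card natr_sum; apply: ler_sum => i _.
lra.
Unshelve. all: by end_near. Qed.

Theorem lemma6p1 (d : measure_display) (T : measurableType d) (R : realType)
    (P : probability T R) (c : nat) (eps : R)
    (r : scheduling_rule) (o : observer) (Q : T -> sample_path R c)
    (alpha ES : R) (U : 'I_c -> T -> R)
    (c_gt0 : (0 < c)%N)
    (eps_bounds : 0 < eps < 8^-1)
    (Qmeas : measurable_system Q)
    (Qinput : {ae P, forall w, valid_input (Q w)})
    (Qgi : GI_GI_input P Q)
    (Qchoice : random_choice P Q)
    (Qsched : {ae P, forall w, scheduled eps r (Q w)})
    (Qserve : {ae P, forall w, nonpreemptive_work_conserving (Q w)})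
    (alphaE : {ae P, forall w, arrival_rate (Q w) alpha})
    (ESE : {ae P, forall w, mean_requirement (Q w) ES})
    (stable : alpha * ES / c%:R < 1)
    (Qcoh : {ae P, forall w, coherent eps r o (Q w)})
    (UE : {ae P, forall w, forall i, busy_fraction eps r o (Q w) i (U i w)}) :
  {ae P, forall w, \sum_(i < c) U i w = alpha * ES}.
Proof.
near=> w.
apply: (sum_busy_fractions (q := Q w) (eps := eps) (r := r) (o := o)) => //.
- by near: w; exact: Qinput.
- by near: w; exact: Qsched.
- by near: w; exact: Qserve.
- by near: w; exact: alphaE.
- by near: w; exact: ESE.
- by near: w; exact: Qcoh.
- by near: w; exact: UE.
Unshelve. all: by end_near. Qed.
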